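(* Let $\mathcal{C}\subset\mathbb{P}^2_{\mathbb{C}}$ be a $d$-arrangement of $k\geq 3$ curves with $d\geq 2$ and with $s$ intersection points. Let $\Bbbk$ be a field and let $I(G)\subset\Bbbk[x_1,\dots,x_s,y_1,\dots,y_k]$ be the edge ideal of the Levi graph $G$ associated with $\mathcal{C}$. Then $\Bbbk[x_1,\dots,x_s,y_1,\dots,y_k]/I(G)$ is not Cohen-Macaulay.
   Context: An arrangement $\mathcal{C}=\{C_1,\dots,C_k\}$ of $k\geq 3$ (distinct) curves in $\mathbb{P}^2_{\mathbb{C}}$ is a $d$-arrangement if all $C_i$ are smooth of the same degree $d\geq 1$ and all points of $\mathrm{Sing}(\mathcal{C})$ are ordinary intersection points, i.e. they look locally like intersections of lines (the curves through the point have pairwise distinct tangents there). Here $\mathrm{Sing}(\mathcal{C})$ is the set of intersection points, i.e. points lying on at least two curves of $\mathcal{C}$. Write $\mathrm{Sing}(\mathcal{C})=\{p_1,\dots,p_s\}$. The Levi graph $G$ of $\mathcal{C}$ is the bipartite graph with vertex set $\{x_1,\dots,x_s\}\cup\{y_1,\dots,y_k\}$ in which $x_j$ and $y_i$ are joined by an edge if and only if $p_j\in C_i$. Its edge ideal $I(G)$ is the ideal generated by all $x_jy_i$ such that $x_j$ and $y_i$ are adjacent. *)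

(* Defs.v *)
From HB Require Import structures.
From mathcomp Require Import all_boot all_order all_algebra.
From mathcomp Require Import mpoly complex boolp classical_sets reals.

Set Implicit Arguments.
Unset Strict Implicit.
Unset Printing Implicit Defensive.

Import GRing.Theory.
Local Open Scope classical_set_scope.
Local Open Scope ring_scope.

(** * Ideals and Cohen-Macaulay rings *)

Section CommutativeAlgebra.
Variable A : comNzRingType.
Implicit Types (I J P : set A) (a : seq A).

Definition is_ideal I : Prop :=
  [/\ I 0, forall x y, I x -> I y -> I (x + y) & forall r x, I x -> I (r * x)].

Definition ideal_gen (G : set A) : set A := smallest is_ideal G.

Definition is_prime_ideal P : Prop :=
  [/\ is_ideal P, ~ P 1 & forall x y, P (x * y) -> P x \/ P y].

Definition is_maximal_ideal P : Prop :=
  [/\ is_ideal P, ~ P 1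
    & forall J, is_ideal J -> ~ J 1 -> P `<=` J -> J = P].

Definition noetherian : Prop :=
  forall I, is_ideal I -> exists a, I = ideal_gen [set` a].

(* The elements of [a] need not be homogeneous: no grading is involved. *)
Definition regular_sequence a : Prop :=
  ~ ideal_gen [set` a] 1 /\
  forall i, (i < size a)%N ->
    forall b, ideal_gen [set` take i a] (a`_i * b) ->
      ideal_gen [set` take i a] b.

Definition regular_sequence_in I (n : nat) : Prop :=
  exists a, [/\ size a = n, [set` a] `<=` I & regular_sequence a].

Definition prime_chain_to P (n : nat) : Prop :=
  exists c : nat -> set A,
    [/\ forall i, (i <= n)%N -> is_prime_ideal (c i),
        forall i, (i < n)%N -> c i `<` c i.+1
      & c n = P].

Definition is_sup_nat (Q : nat -> Prop) (n : nat) : Prop :=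
  Q n /\ forall m, Q m -> (m <= n)%N.

Definition depth_is I (n : nat) : Prop := is_sup_nat (regular_sequence_in I) n.

Definition height_is P (n : nat) : Prop := is_sup_nat (prime_chain_to P) n.

(* Eisenbud, Commutative Algebra, Section 18.2: a Noetherian ring is
   Cohen-Macaulay if depth P = codim P for every maximal ideal P. Here depth P
   is the length of a longest regular sequence in P, which is the depth of the
   local ring A_P, and codim P is the height of P, the dimension of A_P. *)
Definition cohen_macaulay : Prop :=
  noetherian /\
  forall P, is_maximal_ideal P -> exists n, depth_is P n /\ height_is P n.

End CommutativeAlgebra.

(** * Edge ideals *)

Section EdgeIdeal.
Variables (K : fieldType) (n : nat) (e : rel 'I_n).

Definition edge_ideal : set {mpoly K[n]} :=
  ideal_gen [set f | exists u v, e u v /\ f = 'X_u * 'X_v].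

Definition edge_ideal_pred : {pred {mpoly K[n]}} :=
  fun f => `[< edge_ideal f >].

Lemma edge_ideal_is_ideal : is_ideal edge_ideal.
Proof.
split=> [J [[]]//|x y Ix Iy J [idJ GJ]|r x Ix J [idJ GJ]].
  by case: (idJ) => _ + _; apply; [exact: Ix|exact: Iy].
by case: (idJ) => _ _; apply; exact: Ix.
Qed.

Lemma edge_ideal_proper : ~ edge_ideal 1.
Proof.
pose J := [set f : {mpoly K[n]} | f.@[fun=> 0] = 0].
move=> /(_ J) J1; have : J 1; last first.
  by rewrite /J /= meval1 => /eqP; rewrite oner_eq0.
apply: J1; split; last first.
  by move=> _ [u [v [_ ->]]]; rewrite /J /= mevalM mevalXU mul0r.
split; rewrite /J /=; first by rewrite meval0.
  by move=> x y x0 y0; rewrite mevalD x0 y0 addr0.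
by move=> r x x0; rewrite mevalM x0 mulr0.
Qed.

Fact edge_ideal_closed : idealr_closed edge_ideal_pred.
Proof.
have [I0 ID IM] := edge_ideal_is_ideal.
split; first exact/asboolP.
  by apply/asboolPn; exact: edge_ideal_proper.
move=> r x y /asboolP Ix /asboolP Iy; apply/asboolP.
by apply: ID => //; apply: IM.
Qed.

HB.instance Definition _ :=
  isIdealr.Build {mpoly K[n]} edge_ideal_pred edge_ideal_closed.

Definition edge_ring : comNzRingType := {ideal_quot edge_ideal_pred}.

End EdgeIdeal.

(** * Curves in the complex projective plane *)

Section PlaneCurves.
Variable R : realType.
Local Notation C := R[i].
Implicit Types (F : {mpoly C[3]}) (v w : 'rV[C]_3).

(* Points are the lines through the origin of C^3. *)
Definition P2 : Type := {L : {vspace 'rV[C]_3} | \dim L == 1%N}.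

Definition line_of (p : P2) : {vspace 'rV[C]_3} := sval p.

Definition form_eval F v : C := F.@[v ord0].

Definition curve F : set P2 :=
  [set p | forall v, v \in line_of p -> form_eval F v = 0].

Definition smooth_form (d : nat) F : Prop :=
  [/\ F != 0, F \is d.-homog
    & forall v, v != 0 -> form_eval F v = 0 ->
        exists j : 'I_3, form_eval F^`M(j) v != 0].

Definition tangent_line F (p : P2) : set P2 :=
  [set q | forall v w, v \in line_of p -> w \in line_of q ->
             \sum_(j < 3) form_eval F^`M(j) v * w ord0 j = 0].

Variable k : nat.
Implicit Type D : 'I_k -> {mpoly C[3]}.

Definition sing D : set P2 :=
  [set p | exists i j, [/\ i != j, curve (D i) p & curve (D j) p]].

Definition d_arrangement (d : nat) D : Prop :=
  [/\ (1 <= d)%N /\ (3 <= k)%N,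
      forall i, smooth_form d (D i),
      injective (fun i => curve (D i))
    & forall p i j, i != j -> curve (D i) p -> curve (D j) p ->
        tangent_line (D i) p <> tangent_line (D j) p].

(* The vertices lshift k j and rshift s i stand for x_j and y_i. *)
Definition levi_graph (s : nat) (p : 'I_s -> P2) D : rel 'I_(s + k) :=
  fun a b =>
    match split a, split b with
    | inl j, inr i | inr i, inl j => p j \in curve (D i)
    | _, _ => false
    end.

End PlaneCurves.

(* Main.v *)
Require Import Defs.
From HB Require Import structures.
From mathcomp Require Import all_boot all_order all_algebra.
From mathcomp Require Import mpoly complex boolp classical_sets reals.
From mathcomp Require Import ring.

Set Implicit Arguments.
Unset Strict Implicit.
Unset Printing Implicit Defensive.

Import GRing.Theory.
Local Open Scope classical_set_scope.
Local Open Scope ring_scope.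

(** Two plane curves of positive degree meet, so the Levi graph has at least one
vertex x_j; and an intersection point lies on at least two curves, so every x_j
has at least two neighbours. The rest is a fact about bipartite graphs: if one
part X is nonempty and each of its vertices has at least two neighbours, then
the edge ring is not Cohen-Macaulay ([edge_ring_not_cohen_macaulay]).

Let Y be the other part, and choose B in Y maximal among the sets for which the
set Z of vertices of X without neighbour in B is nonempty. By maximality every
z in Z is joined to every vertex of Y \ B, and Y \ B has at least two elements,
since it contains the neighbours of z ([maximal_nondominating]). Let P be the
maximal ideal of the point a whose coordinates are 1 on B and 0 elsewhere. Near
a the variables of B are units, so the vertices of X \ Z become zero, and what
remains of the graph is the complete bipartite graph on Z and Y \ B: the scheme
is locally the union of the flats {X = 0} and {X \ Z = 0, Y \ B = 0}, which meet
in a flat of dimension |B|.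

The first flat has dimension |Y|, so P has height at least |Y| >= |B| + 2
([height_bound]). On the other hand P has depth at most |B| + 1
([depth_bound]): cutting the two flats by the |B| equations X_b = 1 and then by
X_z + X_y, with z in Z and y in Y \ B, leaves a ring in which the class of X_z
is killed by P and is not zero near a. That every regular sequence in P is then
as short as this one is proved with Koszul cohomology: if f is a regular
sequence of length m, then H^i(f; -) vanishes for i < m, passing to the quotient
by a nonzero divisor costs one degree ([acyclic_adjoin]), while an element
killed by P is a class in H^0 ([acyclic_socle]). Localization at a is replaced by
working up to powers of the product of the variables of B.

The meeting point of two curves P = 0 and Q = 0 of degree d comes from
elimination: if P(0, 0, 1) = 1, then P is monic in the last variable, and the
determinant of Q evaluated at the companion matrix of P is a polynomial in the
first two variables which vanishes at the origin, hence also at another point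
(a, b); over (a, b) the two polynomials have a common root. *)

(** * Ideals, regular sequences and quotients *)

Section IdealTheory.
Variable A : comNzRingType.
Implicit Types (J : set A) (fs : seq A).

(** The ideal J + (z); with [foldl] it gives J + (z_1, ..., z_r). *)
Definition adjoin J (z : A) : set A := [set x | exists g : A, J (x - z * g)].

Lemma adjoin_ideal J z : is_ideal J -> is_ideal (adjoin J z).
Proof.
move=> [J0 JD JM]; split.
- by exists 0; rewrite mulr0 subr0.
- move=> x y [g Jg] [h Jh]; exists (g + h).
  rewrite (_ : _ - _ = (x - z * g) + (y - z * h)); last by ring.
  exact: JD.
- move=> r x [g Jg]; exists (r * g).
  rewrite (_ : _ - _ = r * (x - z * g)); last by ring.
  exact: JM.
Qed.

Lemma sub_adjoin J z : J `<=` adjoin J z.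
Proof. by move=> x Jx; exists 0; rewrite mulr0 subr0. Qed.

Lemma ideal_opp J x : is_ideal J -> J x -> J (- x).
Proof. by case=> _ _ JM Jx; rewrite -mulN1r; exact: JM. Qed.

Lemma ideal_sub J x y : is_ideal J -> J x -> J y -> J (x - y).
Proof.
by move=> Jid Jx Jy; case: (Jid) => _ JD _; apply: JD => //; exact: ideal_opp.
Qed.

Lemma colon_ideal J g : is_ideal J -> is_ideal [set f | J (f * g)].
Proof.
move=> [J0 JD JM]; split=> /= [|x y Jx Jy|r x Jx]; first by rewrite mul0r.
  by rewrite mulrDl; apply: JD.
by rewrite -mulrA; apply: JM.
Qed.

(** Weak regularity on A/J: the quotient by the whole sequence may be zero. *)
Fixpoint weakly_regular J fs : Prop :=
  if fs is f :: fs' then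
    (forall x, J (f * x) -> J x) /\ weakly_regular (adjoin J f) fs'
  else True.

Lemma sub_foldl_adjoin J fs : J `<=` foldl adjoin J fs.
Proof.
elim: fs J => [|f fs IH] J //= x Jx.
by apply: IH; exact: sub_adjoin.
Qed.

Lemma foldl_adjoin_ideal J fs : is_ideal J -> is_ideal (foldl adjoin J fs).
Proof. by elim: fs J => [|f fs IH] J //= Jid; apply/IH/adjoin_ideal. Qed.

Lemma mem_adjoin J z : is_ideal J -> adjoin J z z.
Proof. by case=> J0 _ _; exists 1; rewrite mulr1 subrr. Qed.

Lemma mem_foldl_adjoin J fs f : is_ideal J -> f \in fs ->
  foldl adjoin J fs f.
Proof.
elim: fs J => [|g fs IH] J Jid //=; rewrite inE => /predU1P[->|ffs].
  by apply: sub_foldl_adjoin; exact: mem_adjoin.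
by apply: IH ffs; exact: adjoin_ideal.
Qed.

Lemma weakly_regularP J fs :
  (forall i, (i < size fs)%N -> forall b,
    foldl adjoin J (take i fs) (fs`_i * b) ->
    foldl adjoin J (take i fs) b) -> weakly_regular J fs.
Proof.
elim: fs J => [|f fs IH] J //= reg; split; first by move=> x; exact: (reg 0%N).
by apply: IH => i ifs b; exact: (reg i.+1).
Qed.

End IdealTheory.

Section Quotient.
Variables (A Q : comNzRingType) (q : {rmorphism A -> Q}) (I : set A).
Hypothesis q_surj : forall r, exists x, q x = r.
Hypothesis q_ker : forall x, q x = 0 <-> I x.
Implicit Types (J : set A) (fs : seq A).

Lemma ker_ideal : is_ideal I.
Proof.
split=> [|x y /q_ker x0 /q_ker y0|r x /q_ker x0]; apply/q_ker.
- exact: rmorph0.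
- by rewrite rmorphD /= x0 y0 addr0.
- by rewrite rmorphM x0 mulr0.
Qed.

Lemma image_ideal J : is_ideal J -> is_ideal (q @` J).
Proof.
move=> [J0 JD JM]; split; first by exists 0; rewrite ?rmorph0.
- by move=> _ _ [x Jx <-] [y Jy <-]; exists (x + y); rewrite ?rmorphD //; apply: JD.
- move=> r _ [x Jx <-]; have [y <-] := q_surj r.
  by exists (y * x); rewrite ?rmorphM //; apply: JM.
Qed.

Lemma imageP J x : is_ideal J -> I `<=` J -> (q @` J) (q x) <-> J x.
Proof.
move=> [J0 JD JM] IJ; split=> [[y Jy qyx]|Jx]; last by exists x.
rewrite -[x](subrK y); apply: JD Jy; apply: IJ; apply/q_ker.
by rewrite rmorphB qyx subrr.
Qed.

Lemma image_prime J : I `<=` J -> is_prime_ideal J -> is_prime_ideal (q @` J).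
Proof.
move=> IJ [Jid J1 Jpr]; split; first exact: image_ideal.
  by rewrite -(rmorph1 q) imageP.
move=> r r'; have [[x <-] [y <-]] := (q_surj r, q_surj r').
by rewrite -rmorphM !imageP //; exact: Jpr.
Qed.

Lemma image_proper J J' : is_ideal J -> is_ideal J' -> I `<=` J ->
  J `<` J' -> q @` J `<` q @` J'.
Proof.
move=> Jid J'id IJ [JJ' J'J]; split; first exact: image_subset.
move=> qJ'J; apply: J'J => x J'x.
by apply/(imageP x Jid IJ); apply: qJ'J; exists x.
Qed.

Lemma image_maximal J : I `<=` J -> is_maximal_ideal J ->
  is_maximal_ideal (q @` J).
Proof.
move=> IJ [Jid J1 Jmax]; split; first exact: image_ideal.
  by rewrite -(rmorph1 q) imageP.
move=> L [L0 LD LM] L1 JL; apply/seteqP; split=> // r.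
have [x <-] := q_surj r => Lx; exists x => //.
have <- // : [set y | L (q y)] = J.
apply: Jmax => [||y Jy] /=; last by apply: JL; exists y.
  split=> /= [|y y' Ly Ly'|y y' Ly]; first by rewrite rmorph0.
    by rewrite rmorphD; exact: LD.
  by rewrite rmorphM; exact: LM.
by rewrite rmorph1.
Qed.

Lemma ideal_gen_image fs x :
  ideal_gen [set` map q fs] (q x) <-> foldl (@adjoin A) I fs x.
Proof.
split=> [|Jx L [[L0 LD LM] fsL]].
  have Fid := foldl_adjoin_ideal fs ker_ideal.
  have IF := @sub_foldl_adjoin _ I fs.
  move=> /(_ (q @` foldl (@adjoin A) I fs)) /= gx; apply/imageP => //.
  apply: gx; split; first exact: image_ideal.
  move=> _ /= /mapP[f ffs ->]; exists f => //.
  exact: mem_foldl_adjoin ker_ideal ffs.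
have {}fsL f : f \in fs -> L (q f) by move=> ffs; apply: fsL; exact: map_f.
have : forall y, I y -> L (q y) by move=> y /q_ker ->.
elim: fs (I) Jx fsL => [|f fs IH] J /= Jx fsL JL; first exact: JL.
apply: IH Jx _ _ => [g gfs|y [g Jg]].
  by apply: fsL; rewrite inE gfs orbT.
rewrite -[y](subrK (f * g)) rmorphD rmorphM; apply: LD; first exact: JL.
by rewrite mulrC; apply: LM; apply: fsL; rewrite mem_head.
Qed.

(** This lets the quotient ring be forgotten: its regular sequences are studied
through lifts that are regular modulo the kernel. *)
Lemma regular_lift fs : regular_sequence (map q fs) -> weakly_regular I fs.
Proof.
move=> [_]; rewrite size_map => reg; apply: weakly_regularP => i ifs b.
rewrite -!ideal_gen_image rmorphM map_take => ?; apply: reg => //.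
by rewrite (nth_map 0).
Qed.

End Quotient.

(** * Koszul cohomology *)

Section Koszul.
Variable A : comNzRingType.
Implicit Types (J : set A) (fs : seq A) (c e : bitseq -> A) (b : bitseq).

(** A cochain is a function on bit lists: the value at b is the coefficient of
the wedge of the e_j with j-th bit true, so the number of true bits is the
degree. Only the lists as long as [fs] matter; leaving the domain larger
avoids dependent types. *)
Definition deg_lt (i : nat) c := forall b, (i <= count id b)%N -> c b = 0.

Definition cong fs J c := forall b, size b = size fs -> J (c b).

(** The differential, built as an iterated mapping cone: the complex of f :: fs
is the cone of multiplication by f on the complex of fs, whose two summands
are indexed by the first bit. *)
Fixpoint koszul fs c b {struct fs} : A :=
  match fs, b with
  | f :: fs', false :: b' => koszul fs' (fun b => c (false :: b)) b'
  | f :: fs', true :: b' =>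
      f * c (false :: b') - koszul fs' (fun b => c (true :: b)) b'
  | _, _ => 0
  end.

Lemma koszul_linear fs x y c e b :
  koszul fs (fun b => x * c b + y * e b) b
  = x * koszul fs c b + y * koszul fs e b.
Proof.
elim: fs c e b => [|f fs IH] c e [|[] b] /=; try ring; last exact: IH.
by rewrite (IH (fun b => c (true :: b)) (fun b => e (true :: b))); ring.
Qed.

Lemma koszulZ fs x c b : koszul fs (fun b => x * c b) b = x * koszul fs c b.
Proof.
have := koszul_linear fs x 0 c c b; rewrite mul0r addr0 => <-.
by congr koszul; apply: funext => b'; ring.
Qed.

Lemma koszulB fs c e b :
  koszul fs (fun b => c b - e b) b = koszul fs c b - koszul fs e b.
Proof.
have := koszul_linear fs 1 (-1) c e b; rewrite mul1r mulN1r => <-.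
by congr koszul; apply: funext => b'; ring.
Qed.

Lemma koszul_ideal fs J c : is_ideal J -> cong fs J c -> cong fs J (koszul fs c).
Proof.
move=> Jid; case: (Jid) => J0 JD JM.
elim: fs c => [|f fs IH] c Jc [|[] b] //= [sb].
  by apply: ideal_sub => //; [apply: JM; apply: Jc; rewrite /= sb
    | apply: IH => // b' sb'; apply: Jc; rewrite /= sb'].
by apply: IH => // b' sb'; apply: Jc; rewrite /= sb'.
Qed.

Lemma koszulK fs c b : koszul fs (koszul fs c) b = 0.
Proof.
elim: fs c b => [|f fs IH] c [|[] b] //=.
by rewrite koszulB koszulZ IH subr0 subrr.
Qed.

Lemma deg_lt_tail i c (x : bool) : deg_lt i c ->
  deg_lt (i - x) (fun b => c (x :: b)).
Proof. by move=> lc b ib; apply: lc; rewrite /= -leq_subLR. Qed.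

Lemma deg_lt0 c : deg_lt 0 c -> c = fun=> 0.
Proof. by move=> lc; apply: funext => b; exact: lc. Qed.

Lemma koszul0 fs b : koszul fs (fun=> 0) b = 0.
Proof.
by elim: fs b => [|f fs IH] [|[] b] //=; rewrite IH mulr0 subr0.
Qed.

Lemma koszul_deg_lt fs i c : deg_lt i c -> deg_lt i.+1 (koszul fs c).
Proof.
case: i => [|i] lc; first by rewrite (deg_lt0 lc) => b _; exact: koszul0.
elim: fs i c lc => [|f fs IH] i c lc [|[] b] //=.
  rewrite add1n ltnS => ib; rewrite lc //= mulr0 sub0r.
  have := deg_lt_tail (x := true) lc; rewrite subn1 /=.
  case: i ib {lc} (lc) => [|i] ib lc lc'.
    by rewrite (deg_lt0 lc') koszul0 oppr0.
  by rewrite (IH _ _ lc') ?oppr0.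
by have := deg_lt_tail (x := false) lc; rewrite subn0 add0n => /IH; exact.
Qed.

(** The cofactor g can be chosen to vanish in the degrees where c does. *)
Lemma cong_adjoin fs J z i c : is_ideal J -> deg_lt i c -> cong fs (adjoin J z) c ->
  exists2 g, deg_lt i g & cong fs J (fun b => c b - z * g b).
Proof.
move=> Jid lc Jc.
have /choice [g gP] b : exists x, ((i <= count id b)%N -> x = 0) /\
    (size b = size fs -> J (c b - z * x)).
  have [ib|ib] := leqP i (count id b).
    exists 0; split=> // _; rewrite lc // mulr0 subr0.
    by case: Jid.
  have [sb|sb] := eqVneq (size b) (size fs).
    by have [x Jx] := Jc b sb; exists x; split.
  by exists 0; split => // /eqP; rewrite (negPf sb).
by exists g => b; case: (gP b).
Qed.

Variable s : A.

(** Vanishing, after inverting s, of the Koszul cohomology H^i(fs; A/J) for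
i < n: a cocycle of degree less than i <= n becomes a coboundary after
multiplication by a power of s. *)
Definition acyclic fs J n := forall i c, (i <= n)%N -> deg_lt i c ->
  cong fs J (koszul fs c) ->
  exists N e, deg_lt i.-1 e /\ cong fs J (fun b => s ^+ N * c b - koszul fs e b).

(** In the cone, a cocycle is a pair (a, a') with a' a cocycle modulo f for the
remaining sequence; by induction a' is d e + f g, and regularity of f
then forces a = d g. *)
Lemma regular_acyclic J fs : is_ideal J -> weakly_regular J fs ->
  forall i c, (i <= size fs)%N -> deg_lt i c -> cong fs J (koszul fs c) ->
  exists e, deg_lt i.-1 e /\ cong fs J (fun b => c b - koszul fs e b).
Proof.
elim: fs J => [|f fs IH] J Jid.
  move=> _ i c; rewrite leqn0 => /eqP -> lc _; exists (fun=> 0); split=> // b _.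
  by rewrite (deg_lt0 lc) subr0; case: Jid.
move=> [regf /(IH _ (adjoin_ideal f Jid)) {}IH] i c i_fs lc Jdc.
case: (Jid) => J0 JD JM.
case: i i_fs lc => [|i] i_fs lc.
  exists (fun=> 0); split=> // b _; rewrite (deg_lt0 lc).
  by rewrite koszul0 subr0.
pose a b := c (false :: b); pose a' b := c (true :: b).
have la' : deg_lt i a' by have := deg_lt_tail (x := true) lc; rewrite subn1.
have Jda' b : size b = size fs -> J (f * a b - koszul fs a' b).
  by move=> sb; apply: (Jdc (true :: b)); rewrite /= sb.
have [|e [le Je]] := IH i a' i_fs la'.
  move=> b /Jda' Jb; exists (a b); rewrite -opprB.
  exact: ideal_opp.
have [|g lg Jg] := cong_adjoin (i := i) Jid _ Je.
  move=> b ib; rewrite la' // sub0r.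
  case: i {i_fs lc la'} ib le => [|i] ib le.
    by rewrite (deg_lt0 le) koszul0 oppr0.
  by rewrite (koszul_deg_lt _ le) ?oppr0.
pose h b := if b is x :: b' then if x then - e b' else g b' else 0.
exists h; split.
  move=> [|[] b] //= ib; last exact: lg.
  by rewrite le ?oppr0 //; case: i {i_fs lc la' le lg} ib.
have hK b : koszul fs (fun b => h (true :: b)) b = - koszul fs e b.
  rewrite -[RHS]mulN1r -koszulZ; congr koszul.
  by apply: funext => b' /=; rewrite mulN1r.
move=> [|[] b] //= [sb].
  rewrite hK opprK; have := Jg b sb; rewrite /a' /=.
  by rewrite (_ : _ - _ - _ = c (true :: b) - (f * g b + koszul fs e b)) //; ring.
apply: regf; rewrite mulrBr.
have -> : f * c (false :: b) - f * koszul fs g b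
  = (f * a b - koszul fs a' b)
    + koszul fs (fun b => a' b - koszul fs e b - f * g b) b.
  by rewrite !koszulB koszulK koszulZ /a; ring.
apply: JD; first exact: Jda'.
exact: (koszul_ideal Jid Jg).
Qed.

(** Ideals with the same localization at s have the same cohomology up to
powers of s. *)
Lemma acyclic_sat fs J J' n : J `<=` J' -> (forall x, J' x -> J (s * x)) ->
  acyclic fs J n -> acyclic fs J' n.
Proof.
move=> JJ' sJ acJ i c i_n lc Jdc.
have lsc : deg_lt i (fun b => s * c b) by move=> b /lc ->; rewrite mulr0.
have [|N [e [le Je]]] := acJ i _ i_n lsc.
  by move=> b sb; rewrite koszulZ; apply: sJ; exact: Jdc.
exists N.+1, e; split=> // b sb; apply: JJ'; have := Je b sb.
by rewrite mulrA -exprSr.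
Qed.

(** Connecting homomorphism of 0 -> A/J -> A/J -> A/(J + z) -> 0: a cocycle c
modulo J + z satisfies d c = z g, and g is a cocycle one degree higher,
so s^N g = d e for some e; then s^N c - z e is a cocycle modulo J. *)
Lemma acyclic_adjoin fs J z n : is_ideal J -> (forall x, J (z * x) -> J x) ->
  acyclic fs J n.+1 -> acyclic fs (adjoin J z) n.
Proof.
move=> Jid zreg acJ i c i_n lc Jdc; case: (Jid) => J0 JD JM.
have [g lg Jg] := cong_adjoin Jid (koszul_deg_lt _ lc) Jdc.
have [||N [e [le Je]]] := acJ i.+1 g _ lg; first by [].
  move=> b sb; apply: zreg; rewrite -[X in J X]opprK; apply: ideal_opp => //.
  have := koszul_ideal Jid Jg sb.
  by rewrite koszulB koszulK koszulZ sub0r.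
have lc' : deg_lt i (fun b => s ^+ N * c b - z * e b).
  by move=> b ib; rewrite lc // le // !mulr0 subr0.
have [||N' [h [lh Jh]]] := acJ i _ _ lc'; first exact: leqW.
  move=> b sb; rewrite koszulB !koszulZ.
  have -> : s ^+ N * koszul fs c b - z * koszul fs e b =
    s ^+ N * (koszul fs c b - z * g b) + z * (s ^+ N * g b - koszul fs e b).
    by ring.
  by apply: JD; apply: JM; [exact: Jg | exact: Je].
exists (N' + N)%N, h; split=> // b sb; exists (s ^+ N' * e b).
have := Jh b sb; rewrite exprD /=.
rewrite (_ : _ - _ - _
  = s ^+ N' * (s ^+ N * c b - z * e b) - koszul fs h b) //; ring.
Qed.

(** An element killed by the sequence is a cocycle of degree zero, and there
are no coboundaries in degree zero. *)
Lemma acyclic_socle fs J u : is_ideal J -> acyclic fs J 1 ->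
  (forall f, f \in fs -> J (f * u)) -> exists N, J (s ^+ N * u).
Proof.
move=> Jid acJ fu; case: (Jid) => J0 JD JM.
pose c b := if has id b then 0 else u.
have lc : deg_lt 1 c by move=> b; rewrite -has_count /c => ->.
have [||N [e [le Je]]] := acJ 1%N c _ lc; first by [].
  elim: fs fu {acJ lc} => [|f fs IH] fu [|[] b] //= [sb].
    rewrite koszul0 subr0 /c /=; case: ifP => _; first by rewrite mulr0.
    by apply: fu; rewrite mem_head.
  by apply: IH => // g gfs; apply: fu; rewrite inE gfs orbT.
exists N; have := Je (nseq (size fs) false); rewrite size_nseq => /(_ erefl).
rewrite (deg_lt0 le) koszul0 subr0 /c.
by rewrite (_ : has _ _ = false) //; apply/hasP => -[x /nseqP[-> _]].
Qed.

End Koszul.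

(** * Coordinate flats in affine space *)

Section Specialization.
Variables (K : fieldType) (n : nat) (a : 'I_n -> K).
Implicit Types (V W : {set 'I_n}) (f g : {mpoly K[n]}) (J : set {mpoly K[n]}).

(** Restriction to the flat on which the coordinates in W agree with those of
the point a. *)
Definition specialize W : {mpoly K[n]} -> {mpoly K[n]} :=
  comp_mpoly [tuple if v \in W then (a v)%:MP else 'X_v | v < n].

HB.instance Definition _ W := GRing.RMorphism.copy (specialize W)
  (comp_mpoly [tuple if v \in W then (a v)%:MP else 'X_v | v < n]).

Lemma specC W c : specialize W c%:MP = c%:MP.
Proof. exact: comp_mpolyC. Qed.

Lemma specX W v : specialize W 'X_v = if v \in W then (a v)%:MP else 'X_v.
Proof. by rewrite /specialize comp_mpolyXU -tnth_nth tnth_mktuple. Qed.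

Lemma mpoly_ring_ind (P : {mpoly K[n]} -> Prop) :
  (forall c, P c%:MP) -> (forall v, P 'X_v) ->
  (forall f g, P f -> P g -> P (f + g)) ->
  (forall f g, P f -> P g -> P (f * g)) -> forall f, P f.
Proof.
move=> PC PX PD PM f; rewrite (mpolyE f).
elim/big_ind: _ => [|*|m _]; [by rewrite -mpolyC0 | exact: PD |].
rewrite -mul_mpolyC mpolyXE_id; apply: (PM) => //.
elim/big_ind: _ => [|*|v _]; [by rewrite -mpolyC1 | exact: PM |].
by elim: (m v) => [|k IH]; rewrite ?expr0 -?mpolyC1 // exprS; apply: PM.
Qed.

Lemma spec_spec V W f : specialize V (specialize W f) = specialize (V :|: W) f.
Proof.
elim/mpoly_ring_ind: f => [c|v|f g ef eg|f g ef eg].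
- by rewrite !specC.
- rewrite !specX inE; case: (v \in W); first by rewrite specC orbT.
  by rewrite specX orbF.
- by rewrite !rmorphD /= ef eg.
- by rewrite !rmorphM /= ef eg.
Qed.

Lemma spec_id W f : specialize W (specialize W f) = specialize W f.
Proof. by rewrite spec_spec finset.setUid. Qed.

Lemma spec_cong W J f : is_ideal J ->
  (forall v, v \in W -> J ('X_v - (a v)%:MP)) -> J (f - specialize W f).
Proof.
move=> [J0 JD JM] JW; elim/mpoly_ring_ind: f => [c|v|f g Jf Jg|f g Jf Jg].
- by rewrite specC subrr.
- by rewrite specX; case: ifP => [/JW //|_]; rewrite subrr.
- by rewrite rmorphD /= opprD addrACA; exact: JD.
- rewrite rmorphM /=.
  have -> : f * g - specialize W f * specialize W g
    = g * (f - specialize W f) + specialize W f * (g - specialize W g) by ring.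
  by apply: JD; exact: JM.
Qed.

Definition flat_ideal W : set {mpoly K[n]} := [set f | specialize W f = 0].

Lemma flat_ideal_prime W : is_prime_ideal (flat_ideal W).
Proof.
rewrite /flat_ideal; split=> /=.
- split=> /= [|x y x0 y0|r x x0]; first by rewrite rmorph0.
    by rewrite rmorphD /= x0 y0 addr0.
  by rewrite rmorphM /= x0 mulr0.
- by rewrite rmorph1 => /eqP; rewrite oner_eq0.
- by move=> x y /eqP; rewrite rmorphM mulf_eq0 => /orP[] /eqP; [left|right].
Qed.

Lemma flat_ideal_ideal W : is_ideal (flat_ideal W).
Proof. by case: (flat_ideal_prime W). Qed.

Lemma flat_ideal_le V W : V \subset W -> flat_ideal V `<=` flat_ideal W.
Proof.
move=> VW f f0; have := spec_spec W V f; rewrite f0 rmorph0.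
by rewrite (finset.setUidPl VW) /flat_ideal /= => <-.
Qed.

Lemma flat_ideal_gen W v : v \in W -> flat_ideal W ('X_v - (a v)%:MP).
Proof. by move=> vW; rewrite /flat_ideal /= rmorphB /= specC specX vW subrr. Qed.

Lemma XsubC_neq0 v c : 'X_v - c%:MP != 0 :> {mpoly K[n]}.
Proof.
apply/eqP => /(congr1 (meval (fun=> c + 1))).
rewrite mevalB mevalXU mevalC meval0 addrAC subrr add0r => /eqP.
by rewrite oner_eq0.
Qed.

Lemma X_neq0 v : 'X_v != 0 :> {mpoly K[n]}.
Proof. by have := XsubC_neq0 v 0; rewrite mpolyC0 subr0. Qed.

Lemma flat_ideal_proper V v : v \notin V -> flat_ideal V `<` flat_ideal (v |: V).
Proof.
move=> vV; split; first exact/flat_ideal_le/finset.subsetUr.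
move=> /(_ ('X_v - (a v)%:MP)) /(_ (flat_ideal_gen (finset.setU11 v V))).
rewrite /flat_ideal /= rmorphB /= specC specX (negPf vV) => /eqP.
exact/negP/XsubC_neq0.
Qed.

(** When all coordinates are fixed, restriction is evaluation at a. *)
Lemma flat_idealT_maximal : is_maximal_ideal (flat_ideal [set: 'I_n]%SET).
Proof.
have [Pid P1 _] := flat_ideal_prime [set: 'I_n]%SET.
split=> // J Jid J1 PJ; apply/seteqP; split=> // f Jf; case: (Jid) => _ JD JM.
have specE : specialize [set: 'I_n]%SET f = f.@[a]%:MP.
  elim/mpoly_ring_ind: f {Jf} => [c|v|f g ef eg|f g ef eg].
  - by rewrite specC mevalC.
  - by rewrite specX inE mevalXU.
  - by rewrite rmorphD /= mevalD mpolyCD -ef -eg.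
  - by rewrite rmorphM /= mevalM mpolyCM -ef -eg.
rewrite /flat_ideal /= specE; have [->|fa] := eqVneq f.@[a] 0; first exact: mpolyC0.
case: J1; have Jc : J f.@[a]%:MP.
  rewrite -[X in J X](subKr f) -specE; apply: ideal_sub => //; apply: PJ.
  by rewrite /flat_ideal /= rmorphB /= spec_id subrr.
by rewrite -(mpolyC1 n K) -(mulVf fa) mpolyCM; apply: JM.
Qed.

End Specialization.

(** * Depth and height at a point of the edge scheme *)

Section EdgeRing.
Variables (K : fieldType) (n : nat) (e : rel 'I_n) (X : {set 'I_n}).
Hypothesis e_sym : ssrbool.symmetric e.
Hypothesis e_bip : forall u v, e u v -> (u \in X) != (v \in X).
Local Notation S := {mpoly K[n]}.
Local Notation I := (@edge_ideal K n e).

(** B is a maximal set of vertices outside X that does not dominate X, and Z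
consists of the vertices of X that it misses. Adding any further vertex y
dominates X, so y is adjacent to all of Z. *)
Lemma maximal_nondominating :
  (exists x, x \in X) ->
  (forall x, x \in X -> exists y y', [/\ y != y', e x y & e x y']) ->
  exists B Z : {set 'I_n},
    [/\ B \subset ~: X, Z \subset X, exists z, z \in Z
     & [/\ forall z b, z \in Z -> b \in B -> ~~ e z b,
           forall x, x \in X -> x \notin Z -> exists2 b, b \in B & e x b,
           forall z y, z \in Z -> y \notin X -> y \notin B -> e z y
         & (#|B| + 2 <= #|~: X|)%N]].
Proof.
move=> [x0 x0X] degX.
pose Z (B : {set 'I_n}) := [set x in X | [forall b in B, ~~ e x b]].
pose P (B : {set 'I_n}) := (B \subset ~: X) && (Z B != finset.set0).
have /ex_maxset[B /maxsetP[/andP[BX /finset.set0Pn[z zZ]] maxB]] : exists B, P B.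
  exists finset.set0; rewrite /P finset.sub0set; apply/finset.set0Pn; exists x0.
  by rewrite inE x0X; apply/forallP => b; rewrite inE.
have ZX : Z B \subset X by apply/fintype.subsetP => x; rewrite inE => /andP[].
have ZB z' b : z' \in Z B -> b \in B -> ~~ e z' b.
  by rewrite inE => /andP[_ /forall_inP]; exact.
exists B, (Z B); split=> //; first by exists z.
split=> //.
- move=> x xX; rewrite inE xX negb_forall => /existsP[b].
  by rewrite negb_imply negbK => /andP[bB exb]; exists b.
- move=> z' y z'Z yX yB; apply: contraNT yB => nez'y.
  rewrite -(maxB (y |: B)) ?finset.setU11 ?finset.subsetUr //.
  apply/andP; split; first by rewrite finset.subUset BX finset.sub1set inE yX.
  apply/finset.set0Pn; exists z'; rewrite inE (fintype.subsetP ZX) //=.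
  by apply/forall_inP => b; rewrite !inE => /predU1P[-> //|]; exact: ZB.
- have [y [y' [yy' ezy ezy']]] := degX z (fintype.subsetP ZX _ zZ).
  have zX := fintype.subsetP ZX _ zZ.
  have outB v : e z v -> v \notin B by move=> ezv; apply: contraL ezv; exact: ZB.
  have outX v : e z v -> v \in ~: X.
    by move=> /e_bip; rewrite zX inE; case: (v \in X).
  have -> : (#|B| + 2 = #|y |: (y' |: B)|)%N.
    rewrite !cardsU1 inE inE (negPf yy') (outB y) ?(outB y') //.
    by rewrite addnA addnC.
  by apply: subset_leq_card; rewrite !finset.subUset !finset.sub1set BX !outX //.
Qed.

Section Depth.
Variables B Z : {set 'I_n}.
Hypothesis BX : B \subset ~: X.
Hypothesis ZX : Z \subset X.
Hypothesis ZB : forall z b, z \in Z -> b \in B -> ~~ e z b.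
Hypothesis domB : forall x, x \in X -> x \notin Z -> exists2 b, b \in B & e x b.
Hypothesis completeZ : forall z y, z \in Z -> y \notin X -> y \notin B -> e z y.

Let a v : K := (v \in B)%:R.
Let X2 := ~: (B :|: Z)%SET.
Local Notation specialize := (specialize a).
Local Notation flat_ideal := (flat_ideal a).
Let T := [set: 'I_n]%SET.
Let s : S := \prod_(v in B) 'X_v.

(** Near a the edge scheme is the union of the flats through a on which the
coordinates in X, respectively in X2, are fixed; D W is the ideal of the
section of this union by the equations X_v = a_v for v in W. *)
Definition two_flats (W : {set 'I_n}) : set S :=
  flat_ideal (X :|: W)%SET `&` flat_ideal (X2 :|: W)%SET.
Local Notation D := two_flats.

Lemma two_flats_ideal W : is_ideal (D W).
Proof.
have [Y0 YD YM] := flat_ideal_ideal a (X :|: W)%SET.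
have [Z0 ZD ZM] := flat_ideal_ideal a (X2 :|: W)%SET.
split=> [//|x y [? ?] [? ?]|r x [? ?]]; split;
  by [exact: YD|exact: ZD|exact: YM|exact: ZM].
Qed.

Lemma notinB v : v \in X -> v \notin B.
Proof. by move=> vX; apply: contraL vX => /(fintype.subsetP BX); rewrite inE. Qed.

Lemma flat_ideal_var (W : {set 'I_n}) v : v \in W -> v \notin B -> flat_ideal W 'X_v.
Proof.
move=> vW vB; have := flat_ideal_gen a vW.
by rewrite /a (negPf vB) mpolyC0 subr0.
Qed.

Lemma specM_var (W : {set 'I_n}) v (f : S) :
  v \in W -> v \notin B -> flat_ideal W ('X_v * f).
Proof.
move=> vW vB; have [_ _ WM] := flat_ideal_ideal a W.
by rewrite mulrC; apply: WM; exact: flat_ideal_var.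
Qed.

Lemma edge_sub_flats : I `<=` D finset.set0.
Proof.
move=> f; apply; split; first exact: two_flats_ideal.
have edge x y : x \in X -> e x y -> D finset.set0 ('X_x * 'X_y).
  move=> xX exy; rewrite /D !finset.setU0; split.
    by apply: specM_var => //; exact: notinB.
  have [xZ|xZ] := boolP (x \in Z); last first.
    by apply: specM_var; rewrite ?inE ?negb_or ?(notinB xX).
  rewrite mulrC; apply: specM_var; last by apply: contraL exy; exact: ZB.
  rewrite !inE negb_or (contraL (ZB xZ)) //=.
  apply/negP => /(fintype.subsetP ZX) yX; by have := e_bip exy; rewrite xX yX.
move=> _ [u [v [euv ->]]]; have := e_bip euv.
have [uX _|uX] := boolP (u \in X); first exact: edge.
by case: (boolP (v \in X)) => // vX _; rewrite mulrC; apply: edge; rewrite // e_sym.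
Qed.

(** The variables of X \ Z have a neighbour in B, so s kills them; the remaining
equations of the union of the two flats are edges between Z and Y \ B. *)
Lemma flats_sat b : D finset.set0 b -> I (s * b).
Proof.
have Iid := @edge_ideal_is_ideal K n e; case: (Iid) => I0 ID IM.
have eI u v : e u v -> I ('X_u * 'X_v).
  by move=> euv L [_]; apply; exists u, v.
pose J : set S := [set f | I (f * s)].
have Jid : is_ideal J by exact: colon_ideal.
case: (Jid) => J0 JD JM.
have IJ f : I f -> J f by move=> If; rewrite /J /= mulrC; exact: IM.
have JX x : x \in X -> x \notin Z -> J 'X_x.
  move=> xX /(domB xX)[y yB exy]; rewrite /J /s /= (bigD1 y) //= mulrA mulrC.
  apply: IM; exact: eI.
have JXy v x : x \in X -> v \in X2 -> J ('X_x * 'X_v).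
  move=> xX; rewrite !inE negb_or => /andP[vB vZ].
  have [vX|vX] := boolP (v \in X); first by apply: JM; exact: JX.
  have [xZ|xZ] := boolP (x \in Z); first by apply: IJ; apply: eI; exact: completeZ.
  by rewrite mulrC; apply: JM; exact: JX.
(* The f in J1 satisfy f = specialize X f modulo J. To make J1 an ideal one adds
   that X_x f is in J for x in X. It contains the equations of the second flat,
   hence b; and specialize X b = 0 since b vanishes on the first flat. *)
pose J1 : set S := [set f | J (f - specialize X f) /\
  forall x, x \in X -> J ('X_x * f)].
have JXf r f : (forall x, x \in X -> J ('X_x * f)) -> J ((r - specialize X r) * f).
  move=> Jf; apply: (spec_cong (J := [set g | J (g * f)])).
    exact: colon_ideal.
  by move=> x xX; rewrite /a (negPf (notinB xX)) mpolyC0 subr0; exact: Jf.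
have J1id : is_ideal J1.
  split; rewrite /J1 /=.
  - by rewrite rmorph0 subr0; split=> // x _; rewrite mulr0.
  - move=> f g [Jf Jf'] [Jg Jg']; split.
      by rewrite rmorphD opprD addrACA; exact: JD.
    by move=> x xX; rewrite mulrDr; apply: JD; [exact: Jf'|exact: Jg'].
  - move=> r f [Jf Jf']; split; last first.
      by move=> x xX; rewrite mulrCA; apply: JM; exact: Jf'.
    rewrite rmorphM /=.
    have -> : r * f - specialize X r * specialize X f
      = (r - specialize X r) * specialize X f + r * (f - specialize X f) by ring.
    apply: JD; last exact: JM.
    apply: JXf => x xX.
    have -> : 'X_x * specialize X f = 'X_x * f - 'X_x * (f - specialize X f) by ring.
    apply: (ideal_sub Jid); [exact: Jf'|exact: JM].
rewrite /D !finset.setU0 => -[bX bX2]; rewrite mulrC.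
suff [] : J1 b by rewrite bX subr0.
rewrite -[b]subr0 -bX2; apply: spec_cong => // v vX2.
have [vB vZ] : v \notin B /\ v \notin Z.
  by move: vX2; rewrite !inE negb_or => /andP.
rewrite /a (negPf vB) mpolyC0 subr0; split; last by move=> x xX; exact: JXy.
rewrite specX; case: ifP => vX; last by rewrite subrr.
by rewrite /a (negPf vB) mpolyC0 subr0; exact: JX.
Qed.

Lemma flats_adjoin W v :
  D (v |: W)%SET = adjoin (D W) ('X_v - (a v)%:MP).
Proof.
have [D0 DD DM] := two_flats_ideal W.
have Aid := adjoin_ideal ('X_v - (a v)%:MP) (two_flats_ideal W).
have [_ D'D D'M] := two_flats_ideal (v |: W)%SET.
apply/seteqP; split=> b.
  rewrite /D !(finset.setUC [set v]%SET) !finset.setUA => -[b1 b2].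
  case: (Aid) => _ AD _; rewrite -[b](subrK (specialize [set v]%SET b)); apply: AD.
    apply: spec_cong => // v'; rewrite inE => /eqP ->.
    apply: mem_adjoin; exact: two_flats_ideal.
  by apply: sub_adjoin; split; rewrite /flat_ideal /= spec_spec.
move=> [g Dg]; rewrite -[b](subrK (('X_v - (a v)%:MP) * g)); apply: D'D.
  case: Dg => g1 g2; split; [apply: flat_ideal_le g1 | apply: flat_ideal_le g2];
    exact/finset.setUS/finset.subsetUr.
rewrite mulrC; apply: D'M; split; apply: flat_ideal_gen;
  by rewrite !inE eqxx !orbT.
Qed.

Lemma flat_ideal_cancel (W : {set 'I_n}) f g :
  specialize W f != 0 -> flat_ideal W (f * g) -> flat_ideal W g.
Proof.
by move=> /eqP f0; have [_ _ pr] := flat_ideal_prime a W => /pr[].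
Qed.

Lemma flats_regular (W : {set 'I_n}) v b : v \in B -> v \notin W ->
  D W (('X_v - (a v)%:MP) * b) -> D W b.
Proof.
move=> vB vW; have vX := fintype.subsetP BX _ vB; rewrite inE in vX.
by move=> [b1 b2]; split; [apply: flat_ideal_cancel b1|apply: flat_ideal_cancel b2];
  rewrite rmorphB /= specC specX !inE ?vB (negPf vW) ?(negPf vX); exact: XsubC_neq0.
Qed.

Section Socle.
Variables z y : 'I_n.
Hypotheses (zZ : z \in Z) (yX : y \notin X) (yB : y \notin B).
Let zX : z \in X := fintype.subsetP ZX _ zZ.
Let zB := notinB zX.
Let yZ : y \notin Z.
Proof. by apply: contra yX => /(fintype.subsetP ZX). Qed.
Local Notation w := ('X_z + 'X_y : S).

Let specXw : specialize (X :|: B)%SET w = 'X_y.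
Proof.
rewrite rmorphD /= !specX !inE zX (negPf yX) (negPf yB) /=.
by rewrite /a (negPf zB) mpolyC0 add0r.
Qed.

Let specX2w : specialize (X2 :|: B)%SET w = 'X_z.
Proof.
rewrite rmorphD /= !specX !inE zZ (negPf yB) (negPf yZ) (negPf zB) /=.
by rewrite /a (negPf yB) mpolyC0 addr0.
Qed.

Let specX2z : specialize (X2 :|: B)%SET 'X_z = 'X_z.
Proof. by rewrite specX !inE zZ (negPf zB). Qed.

(** X_z + X_y is nonzero on both flats, being X_y on the first one and X_z on
the second. *)
Lemma flats_diagonal_regular b : D B (w * b) -> D B b.
Proof.
move=> [b1 b2]; split; [apply: flat_ideal_cancel b1|apply: flat_ideal_cancel b2];
  by rewrite (specXw, specX2w); exact: X_neq0.
Qed.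

(** Modulo D B and w, the element X_z is killed by the ideal of a: X_z X_v is
zero on both flats for v outside B and Z, while X_z X_v = X_v w - X_v X_y
for v in Z. *)
Lemma point_sub_colon f : flat_ideal T f -> adjoin (D B) w (f * 'X_z).
Proof.
have Aid := adjoin_ideal w (two_flats_ideal B); case: (Aid) => A0 AD AM.
have [_ DD DM] := two_flats_ideal B.
have prodD u v : u \in (X :|: B)%SET -> u \notin B -> v \in (X2 :|: B)%SET ->
    v \notin B -> D B ('X_u * 'X_v).
  move=> ? ? ? ?; split; last rewrite mulrC; exact: specM_var.
move=> fT; rewrite -[f]subr0 -fT.
apply: (spec_cong (J := [set g | adjoin (D B) w (g * 'X_z)])).
  exact: colon_ideal.
move=> v _; rewrite /= mulrC; have [vB|vB] := boolP (v \in B).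
  apply: AM; apply: sub_adjoin; split; apply: flat_ideal_gen; by rewrite inE vB orbT.
rewrite /a (negPf vB) mpolyC0 subr0.
have [vZ|vZ] := boolP (v \in Z); last first.
  by apply: sub_adjoin; apply: prodD; rewrite // !inE ?zX ?negb_or ?vB ?vZ.
have vX := fintype.subsetP ZX _ vZ.
have -> : 'X_z * 'X_v = 'X_v * w - 'X_v * 'X_y :> S by ring.
apply: (ideal_sub Aid); last first.
  by apply: sub_adjoin; apply: prodD; rewrite // !inE ?vX ?negb_or ?yB ?yZ.
by apply: AM; apply: mem_adjoin; exact: two_flats_ideal.
Qed.

(** X_z itself stays nonzero near a: if t X_z = c w on the two flats, then
c = 0 on the first flat and t = c on the second, so t vanishes at a. *)
Lemma colon_sub_point t : adjoin (D B) w (t * 'X_z) -> flat_ideal T t.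
Proof.
have [_ TD _] := flat_ideal_ideal a T.
move=> [c [/eqP c1 /eqP c2]].
have sub (W : {set 'I_n}) : flat_ideal W `<=` flat_ideal T.
  by apply: flat_ideal_le; exact: finset.subsetT.
move: c1; rewrite rmorphB !rmorphM /= specXw specX inE zX /= /a (negPf zB).
rewrite mpolyC0 mulr0 sub0r oppr_eq0 mulf_eq0 (negPf (X_neq0 _ _)) /= => /eqP c1.
move: c2; rewrite rmorphB !rmorphM /= specX2w specX2z mulrC -mulrBr mulf_eq0.
rewrite (negPf (X_neq0 _ _)) /= -rmorphB => /eqP c2.
by rewrite -[t](subrK c); apply: TD; [exact: sub c2|exact: sub c1].
Qed.

(** A longer regular sequence would make the cohomology of the two flats vanish
in degrees 0, ..., |B| + 1; after the |B| sections by X_v = 1 and the one by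
w, the class of X_z in degree zero would still have to vanish. *)
Lemma depth_bound fs : weakly_regular I fs ->
  (forall f, f \in fs -> flat_ideal T f) -> (size fs <= #|B| + 1)%N.
Proof.
move=> reg fT; rewrite leqNgt addn1; apply/negP => szfs.
have ac0 : acyclic s fs (D finset.set0) (#|B| + 2).
  apply: acyclic_sat edge_sub_flats flats_sat _ => i c i_fs lc dc.
  have [|f [lf Jf]] := regular_acyclic (@edge_ideal_is_ideal K n e) reg _ lc dc.
    by rewrite (leq_trans i_fs) // addn2.
  by exists 0%N, f; split=> // b sb; rewrite expr0 mul1r; exact: Jf.
have ac m (W : {set 'I_n}) : #|W| = m -> W \subset B ->
    acyclic s fs (D W) (#|B| + 2 - m).
  elim: m W => [|m IH] W Wm WB.
    by move/eqP: Wm; rewrite cards_eq0 => /eqP ->; rewrite subn0.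
  have /finset.set0Pn[v vW] : W != finset.set0 by rewrite -card_gt0 Wm.
  have Wv : #|W :\ v| = m by move: Wm; rewrite (cardsD1 v) vW => -[].
  rewrite -(finset.setD1K vW) flats_adjoin; apply: acyclic_adjoin.
  - exact: two_flats_ideal.
  - move=> x; apply: (@flats_regular _ v); last by rewrite !inE eqxx.
    exact: fintype.subsetP WB _ vW.
  - rewrite -subSn; first by rewrite subSS; apply: IH => //;
      exact: fintype.subset_trans (finset.subD1set _ _) WB.
    by rewrite -Wm (leq_trans (subset_leq_card WB)) // leq_addr.
have := ac _ B erefl (subxx _); rewrite addnC addnK => /acyclic_adjoin.
move=> /(_ w (two_flats_ideal B) flats_diagonal_regular) /acyclic_socle.
move=> /(_ 'X_z (adjoin_ideal w (two_flats_ideal B))) [].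
  by move=> f /fT; exact: point_sub_colon.
move=> N /colon_sub_point; rewrite /flat_ideal /= rmorphXn rmorph_prod /=.
rewrite big1 ?expr1n; first by move/eqP; rewrite oner_eq0.
by move=> v vB; rewrite specX inE /a vB mpolyC1.
Qed.

End Socle.
End Depth.
End EdgeRing.

Section HeightBound.
Variables (K : fieldType) (n : nat) (a : 'I_n -> K) (X : {set 'I_n}).
Variables (Q : comNzRingType) (q : {rmorphism {mpoly K[n]} -> Q}).
Variable I : set {mpoly K[n]}.
Hypothesis q_surj : forall r, exists x, q x = r.
Hypothesis q_ker : forall x, q x = 0 <-> I x.
Hypothesis IX : I `<=` flat_ideal a X.

(** Starting from the flat on which the coordinates in X are fixed, fixing the
others one after the other gives the chain. *)
Lemma height_bound :
  prime_chain_to (q @` flat_ideal a [set: 'I_n]%SET) #|~: X|.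
Proof.
pose V i := (X :|: [set v in take i (enum (~: X))])%SET.
have VX i : I `<=` flat_ideal a (V i).
  apply: subset_trans IX _; apply: flat_ideal_le.
  exact: finset.subsetUl.
exists (fun i => q @` flat_ideal a (V i)); split.
- move=> i _; apply: (image_prime q_surj q_ker) => //; exact: flat_ideal_prime.
- move=> i iX; apply: (image_proper q_ker) => //; try exact: flat_ideal_ideal.
  have iX' : (i < size (enum (~: X)))%N by rewrite -cardE.
  have [v0 _] : exists v, v \in ~: X by apply/card_gt0P; exact: leq_ltn_trans iX.
  pose v := nth v0 (enum (~: X)) i.
  have -> : V i.+1 = (v |: V i)%SET.
    apply/finset.setP => u; rewrite !inE (take_nth v0) // mem_rcons inE.
    by rewrite orbCA.
  apply: flat_ideal_proper; rewrite inE negb_or.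
  have : v \in enum (~: X) by exact: mem_nth.
  rewrite mem_enum finset.in_setC => -> /=; rewrite inE.
  have := enum_uniq (~: X).
  rewrite -{1}(cat_take_drop i (enum (~: X))) cat_uniq => /and3P[_ /hasPn dis _].
  have := dis v.
  by rewrite (drop_nth v0) // mem_head => /(_ isT).
- congr (q @` flat_ideal a _); apply/finset.setP => v.
  by rewrite !inE cardE take_size mem_enum inE orbN.
Qed.

End HeightBound.

(** At the maximal ideal of the point 1_B, the height is at least |B| + 2 and the
depth at most |B| + 1. *)
Theorem edge_ring_not_cohen_macaulay (K : fieldType) (n : nat) (e : rel 'I_n)
    (X : {set 'I_n}) :
  ssrbool.symmetric e -> (forall u v, e u v -> (u \in X) != (v \in X)) ->
  (exists x, x \in X) ->
  (forall x, x \in X -> exists y y', [/\ y != y', e x y & e x y']) ->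
  ~ cohen_macaulay (edge_ring K e).
Proof.
move=> e_sym e_bip X0 Xdeg [_ CM].
have [B [Z [BX ZX [z zZ] [ZB domB complZ cardB]]]] :=
  maximal_nondominating e_bip X0 Xdeg.
pose q : {rmorphism {mpoly K[n]} -> edge_ring K e} :=
  \pi_{ideal_quot (@edge_ideal_pred K n e)}%qT.
have q_surj r : exists x, q x = r by exists (repr r); exact: reprK.
have q_ker x : q x = 0 <-> @edge_ideal K n e x.
  rewrite -(rmorph0 q); split=> [/eqP|Ix].
    by rewrite -Quotient.idealrBE subr0 => /asboolP.
  by apply/eqP; rewrite -Quotient.idealrBE subr0; apply/asboolP.
pose T := [set: 'I_n]%SET; pose a v : K := (v \in B)%:R.
have IX : @edge_ideal K n e `<=` flat_ideal a X.
  move=> f /(edge_sub_flats e_sym e_bip BX ZX ZB)[].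
  by rewrite !finset.setU0.
have IT : @edge_ideal K n e `<=` flat_ideal a T.
  by apply: subset_trans IX _; apply: flat_ideal_le; exact: finset.subsetT.
have Pmax := image_maximal q_surj q_ker IT (flat_idealT_maximal a).
have [m [[[r [szr rP regr]] _] [_ maxm]]] := CM _ Pmax.
have hm := maxm _ (height_bound q_surj q_ker IX).
have [fs fsE] : exists fs, map q fs = r.
  have /choice[g gK] := q_surj; exists (map g r).
  by rewrite -map_comp (eq_map gK) map_id.
have [y [_ [_ ezy _]]] := Xdeg z (fintype.subsetP ZX z zZ).
have yX : y \notin X.
  by have := e_bip _ _ ezy; rewrite (fintype.subsetP ZX z zZ); case: (y \in X).
have yB : y \notin B by apply: contraL ezy; exact: ZB.
have := leq_trans cardB hm; rewrite -szr -fsE size_map addn2 => szfs.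
suff : (size fs <= #|B| + 1)%N by rewrite leqNgt addn1 szfs.
apply: (depth_bound e_sym e_bip BX ZX ZB domB complZ zZ yX yB (K := K)).
  by apply: (regular_lift q_surj q_ker); rewrite fsE.
move=> f ffs; apply/(imageP q_ker f (flat_ideal_ideal a T) IT); apply: rP.
by rewrite /= -fsE; apply: map_f.
Qed.

(** * Intersection of two plane curves *)

(** Either h is constant in its outer variable, and then (0, 1) is a zero like
(0, 0); or some a <> 0 leaves its leading coefficient nonzero, and then the
polynomial in b that remains has a root. *)
Lemma bivariate_zero (F : closedFieldType) (h : {poly {poly F}}) :
  h.[0].[0] = 0 ->
  exists a b, (a != 0) || (b != 0) /\ h.[b%:P].[a] = 0.
Proof.
move=> h0; have [sh|sh] := leqP (size h) 1.
  exists 0, 1; rewrite oner_neq0 orbT; split=> //.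
  by move: h0; rewrite (size1_polyC sh) !hornerC.
have lX0 : lead_coef h * 'X != 0.
  by rewrite mulf_neq0 ?polyX_eq0 // lead_coef_eq0 -size_poly_gt0 (ltn_trans _ sh).
have [a] := closed_nonrootP _ lX0.
rewrite rootM negb_or rootX => /andP[la a0].
have : size (map_poly (horner_eval a) h) != 1%N.
  by rewrite size_map_poly_id0 ?neq_ltn ?sh ?orbT // /horner_eval.
move=> /closed_rootP[b /rootP hb]; exists a, b; rewrite a0; split=> //.
by rewrite -[RHS]hb -[b in RHS](hornerC b a) -!/(horner_eval _ _) -horner_map.
Qed.

(** If g were coprime to the characteristic polynomial, a Bezout relation
evaluated at M would invert g(M), by the Cayley-Hamilton theorem. *)
Lemma common_root_horner_mx (F : closedFieldType) (n : nat) (M : 'M[F]_n.+1)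
    (g : {poly F}) :
  \det (horner_mx M g) = 0 -> exists2 c, root (char_poly M) c & root g c.
Proof.
move=> detg; apply: contrapT => no_root.
have /Bezout_eq1_coprimepP[[u v] /= uv] : coprimep (char_poly M) g.
  apply/Pdiv.ClosedField.coprimepP => c Mc; apply/negP => gc.
  by apply: no_root; exists c.
have /(congr1 (fun N => \det N)) : horner_mx M v * horner_mx M g = 1.
  by rewrite -rmorphM -(rmorph1 (horner_mx M)) -uv rmorphD !rmorphM /=
     Cayley_Hamilton mulr0 add0r.
by rewrite det_mulmx detg mulr0 det1 => /eqP; rewrite eq_sym oner_eq0.
Qed.

Lemma monic_char_poly (A : comNzRingType) (d : nat) (f : {poly A}) :
  f \is monic -> size f = d.+2 -> exists M : 'M[A]_d.+1, char_poly M = f.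
Proof.
move=> fmon szf; have := companionmxK fmon.
by move: (companionmx f); rewrite szf => M <-; exists M.
Qed.

Lemma prod3 (A : comNzRingType) (f : 'I_3 -> A) :
  \prod_i f i = f 0 * f 1 * f 2%:R.
Proof.
rewrite !big_ord_recr big_ord0 /= mul1r.
by congr (f _ * f _ * f _); exact: val_inj.
Qed.

Section PlaneForms.
Variable F : closedFieldType.
Implicit Types (P Q : {mpoly F[3]}).

Definition affine_pt (a b c : F) : 'I_3 -> F := tnth [tuple a; b; c].

(** P as a polynomial in its last variable; the inner and outer variables of
the coefficients are the first and the second variable. *)
Definition as_poly P : {poly {poly {poly F}}} :=
  mmap (polyC \o polyC \o polyC)
    (tnth [tuple 'X%:P%:P; 'X%:P; 'X]) P.

Definition ev (a b : F) : {poly {poly F}} -> F :=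
  horner_eval a \o horner_eval b%:P.

HB.instance Definition _ a b := GRing.RMorphism.copy (ev a b)
  (horner_eval a \o horner_eval b%:P).

Lemma as_polyE P : as_poly P = \sum_(m <- msupp P)
  (P@_m)%:P%:P%:P * ('X%:P%:P ^+ m 0 * 'X%:P ^+ m 1 * 'X ^+ m 2%:R).
Proof.
rewrite /as_poly /mmap; apply: eq_bigr => m _; congr (_ * _).
by rewrite /mmap1 prod3.
Qed.

Lemma evalE P a b c : P.@[affine_pt a b c] = \sum_(m <- msupp P)
  P@_m * (a ^+ m 0 * b ^+ m 1 * c ^+ m 2%:R).
Proof.
rewrite mevalE; apply: eq_bigr => m _; congr (_ * _).
by rewrite prod3.
Qed.

Lemma map_as_poly P a b : map_poly (ev a b) (as_poly P) =
  \sum_(m <- msupp P) (P@_m * (a ^+ m 0 * b ^+ m 1))%:P * 'X ^+ m 2%:R.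
Proof.
have evC c : ev a b c%:P%:P = c by rewrite /ev /= /horner_eval !hornerE.
have evX : ev a b 'X%:P = a by rewrite /ev /= /horner_eval !hornerE.
have evY : ev a b 'X = b by rewrite /ev /= /horner_eval !hornerE.
rewrite as_polyE rmorph_sum; apply: eq_bigr => m _.
rewrite !rmorphM !rmorphXn /= !map_polyC map_polyX /= evC evX evY.
by rewrite mulrA.
Qed.

Lemma eval_as_poly P a b c :
  (map_poly (ev a b) (as_poly P)).[c] = P.@[affine_pt a b c].
Proof.
rewrite map_as_poly evalE horner_sum; apply: eq_bigr => m _.
by rewrite hornerCM hornerXn [RHS]mulrA.
Qed.

Lemma homog_coef d P : P \is d.-homog ->
  forall m, m \in msupp P -> (m 0%R + m 1%R + m 2%R)%N = d.
Proof.
move=> /dhomogP homP m /homP /= <-; rewrite mdegE !big_ord_recr big_ord0 /=.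
by congr (m _ + m _ + m _)%N; exact: val_inj.
Qed.

Local Notation apex P := P.@[affine_pt 0 0 1].

(** A monomial of degree d either is the d-th power of the last variable or
vanishes at the points (0, 0, c). *)
Lemma apex_term d P m : P \is d.-homog -> m \in msupp P ->
  m 2%:R = d /\ (m 0 = 0%N /\ m 1 = 0%N) \/
  (m 2%:R < d)%N /\ (0 ^+ m 0 * 0 ^+ m 1 = 0 :> F).
Proof.
move=> homP /(homog_coef homP) <-.
case: (m 0) => [|i]; last first.
  by right; split; [rewrite !addSn ltnS leq_addl | rewrite exprS !mul0r].
case: (m 1) => [|j]; first by left.
by right; split; [rewrite !addSn ltnS leq_addl | rewrite exprS mul0r mulr0].
Qed.

Let pow00 (A : comNzRingType) (x y z : A) i : x ^+ 0 * y ^+ 0 * z ^+ i = z ^+ i.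
Proof. by rewrite !expr0 !mul1r. Qed.

Let assoc0 (A : comNzRingType) (x y z w c : A) :
  c * (x * y * z) - 0 * w = c * (x * y) * z.
Proof. by rewrite mul0r subr0 !mulrA. Qed.

(** The last variable occurs to the power d only in its own d-th power, so the
coefficient of degree d is constant. *)
Lemma as_poly_lead d P : P \is d.-homog ->
  (size (as_poly P - (apex P)%:P%:P%:P * 'X^d)%R <= d)%N.
Proof.
move=> homP; rewrite as_polyE evalE !rmorph_sum mulr_suml -sumrB /=.
rewrite big_seq; elim/big_ind: _ => [|f g sf sg|m mP].
- by rewrite size_poly0.
- by rewrite (leq_trans (size_polyD _ _)) // geq_max sf.
have [[-> [-> ->]]|[md m0]] := apex_term homP mP.
  have -> : 'X%:P%:P ^+ 0 * 'X%:P ^+ 0 * 'X ^+ d = 'X ^+ d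
    :> {poly {poly {poly F}}} by exact: pow00.
  by rewrite (pow00 (0 : F)) expr1n mulr1 subrr size_poly0.
have -> : P@_m * (0 ^+ m 0 * 0 ^+ m 1 * 1 ^+ m 2%:R) = 0.
  by rewrite m0 mul0r mulr0.
pose u : {poly {poly F}} := (P@_m)%:P%:P * ('X%:P ^+ m 0 * 'X ^+ m 1).
have -> : (P@_m)%:P%:P%:P * ('X%:P%:P ^+ m 0 * 'X%:P ^+ m 1 * 'X ^+ m 2%:R)
    - (0 : F)%:P%:P%:P * 'X^d = u%:P * 'X ^+ m 2%:R.
  rewrite /u polyCM (polyCM ('X%:P ^+ m 0)) (polyC_exp (m 0)) (polyC_exp (m 1)).
  have -> : (0 : F)%:P%:P%:P = 0 :> {poly {poly {poly F}}} by rewrite !polyC0.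
  exact: assoc0.
rewrite (leq_trans (size_polyMleq _ _)) // size_polyXn addnS /=.
by rewrite (leq_trans _ md) // -[X in (_ <= X)%N]add1n leq_add2r size_polyC leq_b1.
Qed.

Lemma as_poly00 d P : P \is d.-homog ->
  map_poly (ev 0 0) (as_poly P) = (apex P)%:P * 'X^d.
Proof.
move=> homP; rewrite map_as_poly evalE !rmorph_sum mulr_suml /=.
rewrite big_seq [RHS]big_seq; apply: eq_bigr => m mP.
have [[-> [-> ->]]|[_ m0]] := apex_term homP mP; first by rewrite expr1n mulr1.
by rewrite m0 mul0r mulr0 polyC0 !mul0r.
Qed.

(** Elimination of the last variable. The determinant h specializes well
because the companion matrix does; over (0, 0) the two forms are multiples
of the d-th power of the last variable, which is zero at the matrix by the
Cayley-Hamilton theorem, so h vanishes there. *)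
Lemma homog_common_zero d P Q : (0 < d)%N -> P \is d.-homog -> Q \is d.-homog ->
  exists a b c, [|| a != 0, b != 0 | c != 0] /\
    P.@[affine_pt a b c] = 0 /\ Q.@[affine_pt a b c] = 0.
Proof.
wlog Pa : P Q / apex P != 0.
  move=> wlogP d0 homP homQ.
  have [Pa|Pa] := eqVneq (apex P) 0; last exact: wlogP.
  have [Qa|Qa] := eqVneq (apex Q) 0; first by exists 0, 0, 1;
    rewrite oner_neq0 !orbT.
  by have [a [b [c [abc [Qc Pc]]]]] := wlogP _ _ Qa d0 homQ homP; exists a, b, c.
wlog P1 : P {Pa} / apex P = 1.
  move=> wlogP d0 homP homQ.
  have [|||//|a [b [c [abc [Pc Qc]]]]] := wlogP ((apex P)^-1 *: P).
  - by rewrite mevalZ mulVf.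
  - by [].
  - exact: dhomogZ.
  exists a, b, c; split=> //; split=> //.
  by move/eqP: Pc; rewrite mevalZ mulf_eq0 invr_eq0 (negPf Pa) => /eqP.
case: d => // d _ homP homQ.
have lP : (size (as_poly P - 'X^(d.+1))%R < d.+2)%N.
  have := as_poly_lead homP; rewrite P1.
  have -> : (1 : F)%:P%:P%:P = 1 :> {poly {poly {poly F}}} by rewrite !polyC1.
  by rewrite mul1r.
have PE : as_poly P = 'X^(d.+1) + (as_poly P - 'X^(d.+1)).
  by rewrite [RHS]addrC subrK.
move: (as_poly P - 'X^(d.+1)) lP PE => low_part lP PE.
have szP : size (as_poly P) = d.+2.
  by rewrite PE size_polyDl size_polyXn.
have monP : as_poly P \is monic.
  by rewrite monicE PE lead_coefDl ?size_polyXn // lead_coefXn.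
have [M ME] := monic_char_poly monP szP.
pose h := \det (horner_mx M (as_poly Q)).
have evh a b : ev a b h =
  \det (horner_mx (map_mx (ev a b) M) (map_poly (ev a b) (as_poly Q))).
  by rewrite -map_horner_mx det_map_mx.
have evM a b : char_poly (map_mx (ev a b) M) = map_poly (ev a b) (as_poly P).
  by rewrite -map_char_poly ME.
have h0 : h.[0].[0] = 0.
  rewrite -[LHS]/(ev 0 0 h) evh (as_poly00 homQ) rmorphM /=.
  have -> : 'X^(d.+1) = char_poly (map_mx (ev 0 0) M).
    by rewrite evM (as_poly00 homP) P1 mul1r.
  by rewrite Cayley_Hamilton mulr0 det0.
have [a [b [ab hab]]] := bivariate_zero h0.
have [] := @common_root_horner_mx _ _ (map_mx (ev a b) M)
  (map_poly (ev a b) (as_poly Q)).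
  by rewrite -evh.
move=> c; rewrite evM /root !eval_as_poly => /eqP Pc /eqP Qc.
by exists a, b, c; rewrite orbA ab.
Qed.

End PlaneForms.

Lemma homog_scale (A : comNzRingType) (n d : nat) (P : {mpoly A[n]}) (c : A)
    (v : 'I_n -> A) : P \is d.-homog ->
  P.@[fun i => c * v i] = c ^+ d * P.@[v].
Proof.
move=> /dhomogP homP; rewrite !mevalE mulr_sumr big_seq [RHS]big_seq.
apply: eq_bigr => m /homP /= <-; rewrite mulrCA; congr (_ * _).
by rewrite mdegE -prodrXr -big_split; apply: eq_bigr => i _; rewrite exprMn.
Qed.

(** * Levi graphs *)

Section Arrangement.
Variables (R : realType) (d k : nat) (C : 'I_k -> {mpoly R[i][3]}).

Lemma sing_neq0 : (1 < k)%N -> d_arrangement d C -> sing C !=set0.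
Proof.
move=> k1 [[d0 _] smoothC _ _].
pose i := Ordinal (ltnW k1); pose j := Ordinal k1.
have [_ homi _] := smoothC i; have [_ homj _] := smoothC j.
have [a [b [c [abc [Pi Pj]]]]] := homog_common_zero d0 homi homj.
pose v : 'rV[R[i]]_3 := \row_l affine_pt a b c l.
have v0 : v != 0.
  apply: contraL abc => /eqP/rowP v0.
  have a0 : a = 0 by have := v0 0; rewrite !mxE.
  have b0 : b = 0 by have := v0 1; rewrite !mxE.
  have c0 : c = 0 by have := v0 2%:R; rewrite !mxE.
  by rewrite a0 b0 c0 eqxx.
have dimv : \dim <[v]> == 1%N by rewrite dim_vline v0.
pose L : P2 R := exist _ <[v]>%VS dimv.
have curveL l : (C l).@[affine_pt a b c] = 0 -> curve (C l) L.
  move=> Cl w /vlineP[t ->]; have [_ homl _] := smoothC l.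
  rewrite /form_eval -[RHS](mulr0 (t ^+ d)) -Cl -homog_scale //.
  by apply: meval_eq => r; rewrite !mxE.
by exists L, i, j; split; [|exact: curveL|exact: curveL].
Qed.

Lemma levi_sym (s : nat) (p : 'I_s -> P2 R) : ssrbool.symmetric (levi_graph p C).
Proof. by move=> u v; rewrite /levi_graph; case: split => ?; case: split. Qed.

End Arrangement.

Theorem corollary6p6 (R : realType) (d k s : nat)
    (C : 'I_k -> {mpoly R[i][3]}) (p : 'I_s -> P2 R) (K : fieldType)
    (hk : (3 <= k)%N) (hd : (2 <= d)%N)
    (hC : d_arrangement d C)
    (p_inj : injective p) (p_sing : range p = sing C) :
  ~ cohen_macaulay (edge_ring K (levi_graph p C)).
Proof.
pose X := [set lshift k j | j : 'I_s].
have XP u : u \in X = (if fintype.split u is inl _ then true else false).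
  apply/imsetP/idP => [[j _ ->]|]; first by rewrite (unsplitK (inl j)).
  by case: splitP => // j uj _; exists j => //; exact: val_inj.
apply: (@edge_ring_not_cohen_macaulay _ _ _ X).
- exact: levi_sym.
- move=> u v; rewrite !XP /levi_graph.
  by case: fintype.split => ?; case: fintype.split.
- have [q] := sing_neq0 (ltnW hk) hC; rewrite -p_sing => -[j _ _].
  by exists (lshift k j); exact: imset_f.
- move=> _ /imsetP[j _ ->].
  have : sing C (p j) by rewrite -p_sing; exists j.
  move=> [i [i' [ii' Ci Ci']]]; exists (rshift s i), (rshift s i').
  rewrite (inj_eq (@rshift_inj _ _)) /levi_graph (unsplitK (inl j)).
  by rewrite !(unsplitK (inr _)); split=> //; exact/mem_set.
Qed.
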